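(* Let $n$ be a positive integer and let $U_n$ be the universal Costas matrix of order $n$. For $k\in\{1,\dots,n\}$ let $S(n,k)$ denote the sum of the entries of the $k$-th column of $U_n$. Then all columns of $U_n$ have equal sums, i.e., there is a number $S(n)$ depending only on $n$ such that $$S(n,k)=S(n)\qquad\text{for all } k\in\{1,\dots,n\}.$$
   Context: A Costas array of order $n$ is an $n\times n$ permutation matrix such that the vectors connecting every two $1$'s are distinct. It is identified with the permutation $\pi$ of $\{1,\dots,n\}$ where $\pi(k)$ is the row index of the $1$ in column $k$; in these terms, the Costas condition is that the vectors $(j-i,\ \pi(j)-\pi(i))$, for $1\le i<j\le n$, are pairwise distinct. It is written as the row $(\pi(1),\dots,\pi(n))$. Let $C(n)$ be the number of distinct Costas arrays of order $n$. The universal Costas matrix (UCM) $U_n$ of order $n$ is the $C(n)\times n$ matrix whose rows are all the distinct Costas arrays of order $n$, each appearing exactly once, listed in canonical order (grouped into blocks by first element, with first elements in ascending order). Writing $c_{m,k}$ for the $(m,k)$ entry of $U_n$, the $k$-th column sum is $S(n,k)=\sum_{m=1}^{C(n)}c_{m,k}$. *)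

(* Defs.v *)
From HB Require Import structures.
From mathcomp Require Import all_boot all_order all_algebra all_fingroup.

Set Implicit Arguments.
Unset Strict Implicit.
Unset Printing Implicit Defensive.

Import GRing.Theory.
Local Open Scope ring_scope.

(* Columns and permutation values are indexed from 0; both coordinates are
   differences, so the shift from {1, ..., n} does not affect them. *)
Definition diff_vector n (pi : 'S_n) (p : 'I_n * 'I_n) : int * int :=
  ((p.2 : nat)%:Z - (p.1 : nat)%:Z, (pi p.2 : nat)%:Z - (pi p.1 : nat)%:Z).

Definition costas n (pi : 'S_n) : bool :=
  dinjectiveb (diff_vector pi) [pred p : 'I_n * 'I_n | (p.1 < p.2)%N].

Definition costas_count (n : nat) : nat := #|[set pi : 'S_n | costas pi]|.

(* The successor restores the values {1, ..., n}. *)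
Definition perm_row n (pi : 'S_n) : 'rV[nat]_n := \row_k (pi k).+1.

(* The order is prescribed only on first elements: inside a block of rows with
   the same first element any order is allowed, the lexicographic one
   included. *)
Record is_UCM n (U : 'M[nat]_(costas_count n, n)) : Prop := IsUCM {
  UCM_rows : forall v : 'rV[nat]_n,
    (exists m, row m U = v) <-> (exists2 pi : 'S_n, costas pi & v = perm_row pi);
  UCM_rows_inj : injective (fun m => row m U);
  UCM_order : forall (k0 : 'I_n) (m1 m2 : 'I_(costas_count n)),
    k0 = 0%N :> nat -> (m1 <= m2)%N -> (U m1 k0 <= U m2 k0)%N
}.

Definition column_sum n (U : 'M[nat]_(costas_count n, n)) (k : 'I_n) : nat :=
  (\sum_(m < costas_count n) U m k)%N.

Lemma UCM_exists n : exists U : 'M[nat]_(costas_count n, n), is_UCM U.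
Proof.
pose f (pi : 'S_n) := (\sum_(k < n | (k : nat) == 0) (pi k : nat))%N.
pose s := sort (relpre f leq) (enum [set pi : 'S_n | costas pi]).
have sz : size s = costas_count n by rewrite size_sort -cardE.
have us : uniq s by rewrite sort_uniq enum_uniq.
have ms pi : (pi \in s) = costas pi by rewrite mem_sort mem_enum inE.
have ss : sorted (relpre f leq) s.
  by apply: sort_sorted => x y; apply: leq_total.
pose U : 'M[nat]_(costas_count n, n) := \matrix_(m, k) (nth 1%g s m k).+1.
have rU m : row m U = perm_row (nth 1%g s m).
  by apply/rowP => k; rewrite !mxE.
exists U; split.
- move=> v; split=> [[m <-]|[pi cpi ->]].
    exists (nth 1%g s m); last exact: rU.
    by rewrite -ms mem_nth // sz.
  have lt_pi : (index pi s < costas_count n)%N by rewrite -sz index_mem ms.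
  by exists (Ordinal lt_pi); rewrite rU /= nth_index // ms.
- move=> m1 m2; rewrite !rU => /rowP e; apply/val_inj/eqP.
  rewrite -(nth_uniq 1%g _ _ us) ?sz ?ltn_ord //; apply/eqP/permP => k.
  by move: (e k); rewrite !mxE => -[] /val_inj.
- move=> k0 m1 m2 k00 le12; rewrite !mxE ltnS.
  have fE pi : f pi = pi k0.
    by rewrite /f (big_pred1 k0) // => k; rewrite /= -val_eqE /= k00.
  rewrite -!fE; apply: (sorted_leq_nth _ _ _ ss) => //.
  + by move=> y x z; apply: leq_trans.
  + by move=> x; apply: leqnn.
  + by rewrite inE sz.
  + by rewrite inE sz.
Qed.

(* Main.v *)
Require Import Defs.
From mathcomp Require Import all_boot all_order all_algebra all_fingroup.
From mathcomp Require Import zify.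

Set Implicit Arguments.
Unset Strict Implicit.
Unset Printing Implicit Defensive.

(** Reversing the values, [pi k |-> n + 1 - pi k], is an involution on Costas
    arrays, so in every column the entries pair up with average [(n + 1) / 2];
    hence twice any column sum is [C(n) * (n + 1)]. *)

Definition flip_values n (pi : 'S_n) : 'S_n := (pi * perm (@rev_ord_inj n))%g.

Lemma flip_valuesE n (pi : 'S_n) k : flip_values pi k = rev_ord (pi k).
Proof. by rewrite permM permE. Qed.

Lemma flip_valuesK n : involutive (@flip_values n).
Proof. by move=> pi; apply/permP => k; rewrite !flip_valuesE rev_ordK. Qed.

(** [rev_ord] sends [x] to [n - x.+1]. The bounds on both values make this truncated subtraction
    exact, so in a difference the constant cancels and only the sign changes. *)
Lemma diff_vector_flip_values n (pi : 'S_n) p :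
  diff_vector (flip_values pi) p =
    ((diff_vector pi p).1, - (diff_vector pi p).2)%R.
Proof.
rewrite /diff_vector !flip_valuesE /=; congr pair.
have := ltn_ord (pi p.1); have := ltn_ord (pi p.2); lia.
Qed.

Lemma costas_flip_values n (pi : 'S_n) : costas (flip_values pi) = costas pi.
Proof.
have impl (s : 'S_n) : costas s -> costas (flip_values s).
  move=> /dinjectiveP inj_s; apply/dinjectiveP => p q lt_p lt_q.
  rewrite !diff_vector_flip_values => -[e1 /GRing.oppr_inj e2].
  by apply: inj_s => //; rewrite /diff_vector; congr pair.
(* The converse is [impl] applied to the flipped permutation, since flipping twice is the
   identity. *)
by apply/idP/idP => /impl //; rewrite flip_valuesK.
Qed.

Lemma perm_row_inj n : injective (@perm_row n).
Proof.
move=> s t /rowP e; apply/permP => k.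
by move: (e k); rewrite !mxE => -[] /val_inj.
Qed.

(** A sum ignores the order of the rows: the rows of [U] and the rows of the Costas permutations are
    duplicate-free lists with the same members, hence rearrangements of each other. *)
Lemma column_sum_perm n (U : 'M[nat]_(costas_count n, n)) (k : 'I_n) :
  is_UCM U -> column_sum U k = \sum_(pi : 'S_n | costas pi) (pi k).+1.
Proof.
case=> rowsU injU _.
pose costas_rows := [seq perm_row pi | pi <- enum [set pi : 'S_n | costas pi]].
have eq_rows : perm_eq [seq row m U | m <- enum 'I_(costas_count n)] costas_rows.
  apply: uniq_perm.
  - by rewrite map_inj_uniq ?enum_uniq.
  - by rewrite map_inj_uniq ?enum_uniq //; apply: perm_row_inj.
  - move=> v; apply/mapP/mapP => [[m _ ev]|[pi]].
      have [|pi cpi ->] := (rowsU v).1; first by exists m.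
      by exists pi; rewrite ?mem_enum ?inE.
    rewrite mem_enum inE => cpi ev.
    have [|m <-] := (rowsU v).2; first by exists pi.
    by exists m; rewrite ?mem_enum.
transitivity (\sum_(v <- [seq row m U | m <- enum 'I_(costas_count n)]) v ord0 k).
  by rewrite big_map big_enum; apply: eq_bigr => m _; rewrite mxE.
rewrite (perm_big _ eq_rows) big_map big_enum /=.
by apply: eq_big => pi; rewrite ?inE ?mxE.
Qed.

Lemma double_sum_costas n (k : 'I_n) :
  (\sum_(pi : 'S_n | costas pi) (pi k).+1).*2 = costas_count n * n.+1.
Proof.
(* Only the second copy of the sum is reindexed; the terms for [pi] then add up to
   [(pi k).+1 + (n - pi k) = n.+1]. *)
rewrite -addnn {2}(reindex_inj (inv_inj (@flip_valuesK n))) /=.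
under [X in _ + X]eq_bigl do rewrite costas_flip_values.
rewrite -big_split /= /costas_count cardsE -sum_nat_const.
by apply: eq_bigr => pi _; rewrite flip_valuesE /=; have := ltn_ord (pi k); lia.
Qed.

Theorem theorem1 (n : nat) (n_gt0 : (0 < n)%N) :
  exists S : nat, forall U : 'M[nat]_(costas_count n, n), is_UCM U ->
    forall k : 'I_n, column_sum U k = S.
Proof.
(* The halving is exact, since the product is the double of a column sum. *)
exists (costas_count n * n.+1)./2 => U ucmU k.
by rewrite (column_sum_perm k ucmU) -(double_sum_costas k) doubleK.
Qed.
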